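(* Let $(Q,* )$ be a quandle. If $Q$ is left orderable, then $Q$ is left circularly orderable; if $Q$ is right orderable, then $Q$ is right circularly orderable.
   Context: A quandle is a non-empty set $Q$ with a binary operation $*$ such that: (1) $s*s=s$ for all $s$; (2) for any $s_1,s_2\in Q$ there exists a unique $s_3\in Q$ with $s_3*s_2=s_1$; (3) $(s_1*s_2)*s_3=(s_1*s_3)*(s_2*s_3)$ for all $s_1,s_2,s_3$. A quandle $Q$ is left orderable (respectively right orderable) if there is a strict total ordering $\prec$ on $Q$ such that $s\prec t$ implies $r*s\prec r*t$ (respectively $s*r\prec t*r$) for all $r,s,t\in Q$. A circular ordering on a set $T$ is a map $c:T\times T\times T\to\{-1,0,1\}$ such that: (1) $c(t_1,t_2,t_3)=0$ if and only if $t_1,t_2,t_3$ are not all distinct (i.e. at least two coincide); (2) $c(t_1,t_2,t_3)-c(t_1,t_2,t_4)+c(t_1,t_3,t_4)-c(t_2,t_3,t_4)=0$ for all $t_1,t_2,t_3,t_4\in T$. A quandle $Q$ is left circularly orderable (respectively right circularly orderable) if there is a circular ordering $c$ on the set $Q$ with $c(s_1,s_2,s_3)=c(s*s_1,s*s_2,s*s_3)$ (respectively $c(s_1,s_2,s_3)=c(s_1*s,s_2*s,s_3*s)$) for all $s,s_1,s_2,s_3\in Q$. *)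

(* Defs.v *)
From Stdlib Require Import ZArith RelationClasses.

Record quandle := Quandle {
  carrier :> Type;
  qop : carrier -> carrier -> carrier;
  quandle_nonempty : inhabited carrier;
  qop_idem : forall s, qop s s = s;
  qop_div : forall s1 s2, exists! s3, qop s3 s2 = s1;
  qop_distr : forall s1 s2 s3,
    qop (qop s1 s2) s3 = qop (qop s1 s3) (qop s2 s3)
}.

Arguments qop {q} _ _.

Declare Scope quandle_scope.
Delimit Scope quandle_scope with quandle.
Infix "*" := qop : quandle_scope.
Open Scope quandle_scope.

Definition strict_total_order {T : Type} (lt : T -> T -> Prop) : Prop :=
  StrictOrder lt /\ forall s t : T, lt s t \/ s = t \/ lt t s.

Definition left_orderable (Q : quandle) : Prop :=
  exists lt : Q -> Q -> Prop,
    strict_total_order lt /\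
    forall r s t : Q, lt s t -> lt (r * s) (r * t).

Definition right_orderable (Q : quandle) : Prop :=
  exists lt : Q -> Q -> Prop,
    strict_total_order lt /\
    forall r s t : Q, lt s t -> lt (s * r) (t * r).

(* A map to {-1, 0, 1} is encoded as a Z-valued map whose values lie in that
   set, so that the cocycle condition is an equation between integers. *)
Record circular_ordering {T : Type} (c : T -> T -> T -> Z) : Prop := {
  circ_values : forall t1 t2 t3,
    c t1 t2 t3 = (-1)%Z \/ c t1 t2 t3 = 0%Z \/ c t1 t2 t3 = 1%Z;
  circ_degenerate : forall t1 t2 t3,
    c t1 t2 t3 = 0%Z <-> t1 = t2 \/ t1 = t3 \/ t2 = t3;
  circ_cocycle : forall t1 t2 t3 t4,
    (c t1 t2 t3 - c t1 t2 t4 + c t1 t3 t4 - c t2 t3 t4)%Z = 0%Z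
}.

Definition left_circularly_orderable (Q : quandle) : Prop :=
  exists c : Q -> Q -> Q -> Z,
    circular_ordering c /\
    forall s s1 s2 s3 : Q, c s1 s2 s3 = c (s * s1) (s * s2) (s * s3).

Definition right_circularly_orderable (Q : quandle) : Prop :=
  exists c : Q -> Q -> Q -> Z,
    circular_ordering c /\
    forall s s1 s2 s3 : Q, c s1 s2 s3 = c (s1 * s) (s2 * s) (s3 * s).

(* Main.v *)
Require Import Defs.
From Stdlib Require Import ZArith Lia RelationClasses ClassicalEpsilon.

(** A strict total order bends into a circular one: going round, an ordered
    triple counts as positive when one of its cyclic rotations is increasing.
    With [order_sign s t] equal to 1, 0 or -1 according to whether [s] is below,
    equal to or above [t], the resulting map is the coboundary
    [c t1 t2 t3 = sign t1 t2 - sign t1 t3 + sign t2 t3], so that the cocycle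
    condition is the identity that a coboundary of a coboundary vanishes; only
    the values of [c] and its zeros use the order axioms
    ([order_cycle_circular]).

    A map that is strictly increasing for a total order preserves signs, hence
    preserves [c] ([order_cycle_increasing]). Left and right orderability say
    that the left, respectively right, translations of the quandle are
    increasing, so both implications follow from the same fact about maps of
    ordered sets. *)

Definition order_sign {T : Type} (lt : T -> T -> Prop) (s t : T) : Z :=
  if excluded_middle_informative (lt s t) then 1%Z
  else if excluded_middle_informative (lt t s) then (-1)%Z
  else 0%Z.

Definition order_cycle {T : Type} (lt : T -> T -> Prop) (t1 t2 t3 : T) : Z :=
  (order_sign lt t1 t2 - order_sign lt t1 t3 + order_sign lt t2 t3)%Z.

Section TotalOrder.

Context {T : Type} (lt : T -> T -> Prop) (lt_total : strict_total_order lt).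

Lemma order_sign_cases (s t : T) :
  (lt s t /\ order_sign lt s t = 1%Z) \/
  (s = t /\ order_sign lt s t = 0%Z) \/
  (lt t s /\ order_sign lt s t = (-1)%Z).
Proof.
  destruct lt_total as [[irr tr] tot].
  unfold order_sign.
  destruct (excluded_middle_informative (lt s t)) as [st | st]; [now left |].
  destruct (excluded_middle_informative (lt t s)) as [ts | ts].
  - now right; right.
  - right; left; split; [| reflexivity].
    destruct (tot s t) as [h | [h | h]]; tauto.
Qed.

Lemma order_cycle_circular : circular_ordering (order_cycle lt).
Proof.
  destruct lt_total as [[irr tr] _].
  split; [| | intros; unfold order_cycle; lia]; intros t1 t2 t3;
    unfold order_cycle;
    destruct (order_sign_cases t1 t2) as [[h12 ->] | [[h12 ->] | [h12 ->]]];
    destruct (order_sign_cases t1 t3) as [[h13 ->] | [[h13 ->] | [h13 ->]]];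
    destruct (order_sign_cases t2 t3) as [[h23 ->] | [[h23 ->] | [h23 ->]]];
    (* A sign pattern outside the range, or with a wrong zero, comes from a
       cycle of comparisons, which transitivity turns into [lt x x]. *)
    try lia; try (split; [intros e | intros [e | [e | e]]]); subst;
    try solve [lia | tauto | exfalso; eapply irr; eauto].
Qed.

Lemma order_sign_increasing (f : T -> T) :
  (forall s t, lt s t -> lt (f s) (f t)) ->
  forall s t, order_sign lt (f s) (f t) = order_sign lt s t.
Proof.
  intros f_incr s t.
  destruct lt_total as [[irr tr] _].
  destruct (order_sign_cases s t) as [[h ->] | [[h ->] | [h ->]]];
    destruct (order_sign_cases (f s) (f t)) as [[h' ->] | [[h' ->] | [h' ->]]];
    subst; try reflexivity; exfalso;
    try apply f_incr in h; try rewrite h' in *; eapply irr; eauto.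
Qed.

Lemma order_cycle_increasing (f : T -> T) :
  (forall s t, lt s t -> lt (f s) (f t)) ->
  forall t1 t2 t3,
    order_cycle lt t1 t2 t3 = order_cycle lt (f t1) (f t2) (f t3).
Proof.
  intros f_incr t1 t2 t3; unfold order_cycle.
  now rewrite !(order_sign_increasing f f_incr).
Qed.

End TotalOrder.

Theorem lemma3p1 (Q : quandle) :
  (left_orderable Q -> left_circularly_orderable Q) /\
  (right_orderable Q -> right_circularly_orderable Q).
Proof.
  split; intros [lt [lt_total lt_inv]]; exists (order_cycle lt);
    (split; [exact (order_cycle_circular lt lt_total) |]); intros s.
  - exact (order_cycle_increasing lt lt_total (fun t => (s * t)%quandle)
             (lt_inv s)).
  - exact (order_cycle_increasing lt lt_total (fun t => (t * s)%quandle)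
             (lt_inv s)).
Qed.
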